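(* For all $\mu>0$ and $L$ there is a $K$ such that the following holds. Let $P$ be a finite poset whose ground set is the disjoint union of chains $X=\{x_1<\cdots<x_m\}$ and $Y=\{y_1<\cdots<y_n\}$, with no relations $x_i>y_j$. Let $(A,B)$ be a $\mu$-pair in $P$ with $A\subseteq X$, $B\subseteq Y$ and $|B|\ge\max\{\mu|A|,K\}$. Then $\sum_{x\in A}\sigma^2(x)\ge L|A|$.
   Context: $f$ is a uniformly random linear extension of $P$ (order-preserving bijection $P\to[m+n]$), and $\sigma(x)$ is the standard deviation of $f(x)$. For disjoint $A,B\subseteq P$, $(A,B)$ is incomparable if no element of $A$ is comparable to any element of $B$; an incomparable $(A,B)$ is a $\mu$-pair if $|A||B|\ge\mu|C||D|$ for every incomparable pair $(C,D)$ in $P$. *)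

(* Defs.v *)
From mathcomp Require Import all_boot all_order all_algebra.
From mathcomp Require Import reals.

Set Implicit Arguments.
Unset Strict Implicit.
Unset Printing Implicit Defensive.

Import Order.TTheory GRing.Theory Num.Theory.
Local Open Scope ring_scope.

Section Posets.
Context {d : Order.disp_t} {P : finPOrderType d}.

Definition is_chain (X : {set P}) : Prop := {in X &, forall x y, (x >=< y)%O}.

Definition incomparable_pair (A B : {set P}) : Prop :=
  [disjoint A & B] /\ {in A & B, forall a b, (a >< b)%O}.

(* The ground set is the disjoint union of the chains X and Y, and no element
   of X lies above an element of Y; relations x < y are allowed. *)
Definition two_chain_poset (X Y : {set P}) : Prop :=
  [/\ is_chain X, is_chain Y, [disjoint X & Y], X :|: Y = [set: P]
    & {in X & Y, forall x y, ~~ (y < x)%O}].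

(* Order-preserving bijections from P to {0, ..., #|P| - 1}; injectivity
   amounts to bijectivity by cardinality, see linext_bijP. *)
Definition linext : {set {ffun P -> 'I_#|P|}} :=
  [set f : {ffun P -> 'I_#|P|} | injectiveb f
     && [forall x, forall y, (x <= y)%O ==> (f x <= f y)%N]].

Lemma linext_bijP (f : {ffun P -> 'I_#|P|}) :
  f \in linext <->
  bijective f /\ (forall x y : P, (x <= y)%O -> (f x <= f y)%N).
Proof.
rewrite inE; split=> [/andP[/injectiveP injf /forallP homf]|[bijf homf]].
  split; first by apply: inj_card_bij injf _; rewrite card_ord.
  by move=> x y; have /forallP/(_ y)/implyP := homf x.
apply/andP; split; first by apply/injectiveP; exact: bij_inj.
by apply/forallP=> x; apply/forallP=> y; apply/implyP; exact: homf.
Qed.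

Variable R : realType.

Definition mu_pair (mu : R) (A B : {set P}) : Prop :=
  incomparable_pair A B /\
  forall C D : {set P}, incomparable_pair C D ->
    mu * (#|C|%:R * #|D|%:R) <= #|A|%:R * #|B|%:R.

(* Expectation under the uniform distribution on linear extensions. *)
Definition linext_mean (g : {ffun P -> 'I_#|P|} -> R) : R :=
  (\sum_(f in linext) g f) / #|linext|%:R.

(* The position f(x) in {1, ..., #|P|}. *)
Definition position (x : P) (f : {ffun P -> 'I_#|P|}) : R := (f x).+1%:R.

Definition sigma (x : P) : R :=
  Num.sqrt (linext_mean
    (fun f => (position x f - linext_mean (position x)) ^+ 2)).

End Posets.

(* Main.v *)
(* A linear extension of P is the same as a nonincreasing sequence s with s_k <=
   c_k, where s_k counts the y's placed before the k-th largest element of X and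
   c_k counts the y's not above it; the mu-pair condition gives the hyperbola
   bound mu k c_k <= |A||B|, and c_k >= |B| up to the largest index k0 in A.
   Put g_k = s_k - s_(k+1).
   - Exchanging the gaps g_i and g_j (i < j) is a partial involution of the set
     of sequences, defined whenever g_i <= g_j because it then lowers s.  Hence
     E psi(g_k) is nonincreasing in k for psi increasing, and the exchange is
     blocked rarely where E g_k^2 hardly varies.
   - Resampling the single value s_k shows Var s_k >= E g_k^2 / 16, that
     E min(s_k, |B|) is concave up to k0 + 1, and E (g_i - g_j)^2 >= E g_j^2 / 16.
     Concavity and the hyperbola bound give E g_k >= const |B| / |A| on the lower
     half of A, which settles the case where |B| / |A| is large.
   - Otherwise |A| is large.  If a positive proportion of the indices had bounded
     variance, pigeonhole would give three of them, k1 < k2 < k3, at mutual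
     distances between r and O(r), with E g_k1^2 - E g_k3^2 tiny.  The exchanges
     of g_i and g_j for k1 <= i < k2 <= j < k3 are then almost measure preserving;
     each moves s_(k2) by g_i - g_j, so order r^2 of them force a covariance of
     order r^2, while bounded variances only allow O(r). *)
Require Import Defs.
From mathcomp Require Import all_boot all_order all_algebra.
From mathcomp Require Import boolp reals.
From mathcomp Require Import zify ring lra.

Set Implicit Arguments.
Unset Strict Implicit.
Unset Printing Implicit Defensive.

Import Order.TTheory GRing.Theory Num.Theory.
Local Open Scope ring_scope.

(** * Concave sequences and a pigeonhole for telescoping sums *)

(** Concavity makes the decrements [D] nondecreasing: those before k are at most [D k], those from k
    on at least [D k]. Eliminating [D k] between the two resulting bounds gives the chord. *)
Lemma concave_chord (R : realFieldType) (a : nat -> R) (N : nat) :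
    (forall k, (0 < k < N)%N -> a k.-1 + a k.+1 <= 2 * a k) ->
  forall k, (k <= N)%N -> (N - k)%:R * a 0%N + k%:R * a N <= N%:R * a k.
Proof.
move=> conc; pose D i := a i - a i.+1.
have mono k j : (k + j < N)%N -> D k <= D (k + j)%N.
  elim: j => [|j IH]; rewrite ?addn0 // addnS => lt.
  apply: le_trans (IH (ltnW lt)) _.
  by have := conc (k + j).+1 lt; rewrite /D /=; lra.
have before k : (k < N)%N -> a 0%N - a k <= k%:R * D k.
  elim: k => [|k IH] lt; first by rewrite subrr mul0r.
  have := IH (ltnW lt); have := mono k 1%N; rewrite addn1 => /(_ lt).
  have : 0 <= k%:R :> R by rewrite ler0n.
  by rewrite -natr1; have : D k = a k - a k.+1 by []; nra.
have after k j : (k + j <= N)%N -> j%:R * D k <= a k - a (k + j)%N.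
  elim: j => [|j IH]; rewrite ?addn0 ?mul0r ?subrr // addnS => lt.
  have := IH (ltnW lt); have := mono k j lt.
  by have : D (k + j)%N = a (k + j)%N - a (k + j).+1 by []; rewrite -natr1; lra.
move=> k; rewrite leq_eqVlt => /predU1P[-> | lt].
  by rewrite subnn mul0r add0r.
have := before _ lt; have := after k (N - k)%N.
rewrite (subnKC (ltnW lt)) => /(_ (leqnn _)).
rewrite (natrB _ (ltnW lt)); have : 0 <= k%:R :> R by rewrite ler0n.
have : k%:R <= N%:R :> R by rewrite ler_nat ltnW.
nra.
Qed.

Lemma telescope_pigeonhole (R : realFieldType) (f : nat -> R) (M : nat) (B : R) :
    (0 < M)%N -> f M - f 0%N <= B ->
  exists2 t, (t < M)%N & M%:R * (f t.+1 - f t) <= B.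
Proof.
move=> M_gt0 leB; apply/not_exists2P => none.
have lt_step t : (t < M)%N -> B < M%:R * (f t.+1 - f t).
  by move=> tM; case: (none t) => // /negP; rewrite -ltNge.
have {}lt_step t : (t < M)%N -> t.+1%:R * B < M%:R * (f t.+1 - f 0%N).
  elim: t => [|t IH] tM; first by rewrite mul1r lt_step.
  by have := IH (ltnW tM); have := lt_step _ tM; rewrite -[in t.+2%:R]natr1; nra.
have := lt_step M.-1; rewrite prednK // leqnn => /(_ isT).
by rewrite ltr_pM2l ?ltr0n // ltNge leB.
Qed.

(** * Uniform nonincreasing sequences under a ceiling *)

Section UniformSequences.
Context {R : realType} {T : finType}.
Context (Om : {set T}) (h : T -> nat -> nat) (c : nat -> nat).

(** Index 0 is a sentinel with a fixed value, so that every free value [s k], k > 0, has a left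
    neighbour. *)
Definition admissible (s : nat -> nat) : Prop :=
  [/\ s 0%N = c 0%N, forall k, (s k <= c k)%N & forall k, (s k.+1 <= s k)%N].

Hypothesis h_adm : forall w, w \in Om -> admissible (h w).
Hypothesis h_surj : forall s, admissible s -> exists2 w, w \in Om & h w = s.
Hypothesis h_inj : {in Om &, injective h}.
Hypothesis Om_neq0 : Om != set0.

(** Functions on [nat] do not form a finite type, so the uniform average over admissible sequences
    is taken through [h], a bijection from [Om] onto them by the hypotheses above. *)
Definition Ex (F : (nat -> nat) -> R) : R :=
  (\sum_(w in Om) F (h w)) / #|Om|%:R.

Lemma card_Om_gt0 : 0 < #|Om|%:R :> R.
Proof. by rewrite ltr0n card_gt0. Qed.

Lemma ExD F G : Ex (fun s => F s + G s) = Ex F + Ex G.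
Proof. by rewrite /Ex big_split mulrDl. Qed.

Lemma ExZ a F : Ex (fun s => a * F s) = a * Ex F.
Proof. by rewrite /Ex -mulr_sumr mulrA. Qed.

Lemma ExB F G : Ex (fun s => F s - G s) = Ex F - Ex G.
Proof. by rewrite /Ex sumrB mulrBl. Qed.

Lemma Ex_cst a : Ex (fun=> a) = a.
Proof.
by rewrite /Ex sumr_const -[a *+ _]mulr_natr mulfK // gt_eqF // card_Om_gt0.
Qed.

Lemma Ex_sum (I : Type) (r : seq I) (F : I -> (nat -> nat) -> R) :
  Ex (fun s => \sum_(i <- r) F i s) = \sum_(i <- r) Ex (F i).
Proof. by rewrite /Ex exchange_big mulr_suml. Qed.

Lemma Ex_le F G :
  (forall s, admissible s -> F s <= G s) -> Ex F <= Ex G.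
Proof.
move=> leFG; rewrite ler_pM2r ?invr_gt0 ?card_Om_gt0 //.
by apply: ler_sum => w /h_adm; apply: leFG.
Qed.

Lemma Ex_eq F G :
  (forall s, admissible s -> F s = G s) -> Ex F = Ex G.
Proof.
by move=> eqFG; apply/le_anti/andP; split; apply: Ex_le => s /eqFG ->.
Qed.

Lemma Ex_ge0 F : (forall s, admissible s -> 0 <= F s) -> 0 <= Ex F.
Proof. by move=> F0; rewrite -[leLHS](Ex_cst 0); apply: Ex_le. Qed.

Lemma Ex_sqr_ge F : Ex F ^+ 2 <= Ex (fun s => F s ^+ 2).
Proof.
have : 0 <= Ex (fun s => (F s - Ex F) ^+ 2) by apply: Ex_ge0 => s _; exact: sqr_ge0.
have -> : Ex (fun s => (F s - Ex F) ^+ 2)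
  = Ex (fun s => F s ^+ 2 - 2 * Ex F * F s + Ex F ^+ 2).
  by apply: Ex_eq => s _; ring.
by rewrite ExD ExB ExZ Ex_cst => H; nra.
Qed.

(** Transported to the finite set [Om], an injective self-map is a permutation, hence preserves the
    uniform measure. *)
Lemma Ex_move (M : (nat -> nat) -> nat -> nat) F :
    (forall s, admissible s -> admissible (M s)) ->
    (forall s t, admissible s -> admissible t -> M s = M t -> s = t) ->
  Ex (fun s => F (M s)) = Ex F.
Proof.
move=> admM injM; rewrite /Ex; congr (_ / _).
have /choice[f fP] w : exists v, w \in Om -> v \in Om /\ h v = M (h w).
  case: (boolP (w \in Om)) => [Omw | _]; last by exists w.
  by have [v Omv hv] := h_surj (admM _ (h_adm Omw)); exists v.
have injf : {in Om &, injective f}.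
  move=> v w Omv Omw eqf; apply: h_inj => //.
  have [_ hv] := fP _ Omv; have [_ hw] := fP _ Omw.
  by apply: injM; rewrite -?hv -?hw ?eqf //; apply: h_adm.
have fOm : f @: Om = Om.
  apply/eqP; rewrite eqEcard card_in_imset // leqnn andbT.
  by apply/subsetP => _ /imsetP[w /fP[Omfw _] ->].
rewrite -[in RHS]fOm big_imset //=; apply: eq_bigr => w Omw.
by have [_ ->] := fP _ Omw.
Qed.

(** [G (M s)] and [G s] have the same second moment, and [(u - v) ^ 2 <= 2 * u ^ 2 + 2 * v ^ 2]. *)
Lemma Ex_sqr_move (M : (nat -> nat) -> nat -> nat) (G D : (nat -> nat) -> R) :
    (forall s, admissible s -> admissible (M s)) ->
    (forall s t, admissible s -> admissible t -> M s = M t -> s = t) ->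
    (forall s, admissible s -> D s ^+ 2 <= (G (M s) - G s) ^+ 2) ->
  Ex (fun s => D s ^+ 2) <= 4 * Ex (fun s => G s ^+ 2).
Proof.
move=> admM injM leD; apply: le_trans (Ex_le leD) _.
have -> : 4 * Ex (fun s => G s ^+ 2)
    = Ex (fun s => 2 * G (M s) ^+ 2 + 2 * G s ^+ 2).
  by rewrite ExD !ExZ (Ex_move (fun s => G s ^+ 2)) //; ring.
by apply: Ex_le => s _; have := sqr_ge0 (G (M s) + G s); nra.
Qed.

Lemma admissible_homo s i j : admissible s -> (i <= j)%N -> (s j <= s i)%N.
Proof.
case=> _ _ mono; elim: j => [|j IH]; first by rewrite leqn0 => /eqP ->.
rewrite leq_eqVlt => /predU1P[-> // | ij].
by apply: leq_trans (mono j) (IH _).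
Qed.

Definition gap (k : nat) (s : nat -> nat) : R := (s k)%:R - (s k.+1)%:R.

Lemma natr_gap s k : admissible s -> (s k - s k.+1)%:R = gap k s.
Proof. by case=> _ _ mono; rewrite natrB. Qed.

Lemma gap_ge0 s k : admissible s -> 0 <= gap k s.
Proof. by move=> adm; rewrite -natr_gap // ler0n. Qed.

Definition mean (k : nat) : R := Ex (fun s => (s k)%:R).

Definition variance (k : nat) : R :=
  Ex (fun s => ((s k)%:R - mean k) ^+ 2).

(** * Exchanging two gaps *)

(** Exchanging the gaps at i and j shifts all values strictly after i and up to j by their
    difference. On admissible sequences the truncated subtraction is exact, since [s k >= s j] is at
    least the gap at j. *)
Definition swap (i j : nat) (s : nat -> nat) : nat -> nat := fun k =>
  if (i < k <= j)%N then (s k + (s i - s i.+1) - (s j - s j.+1))%N else s k.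

Lemma swap_in i j s k : (i < k <= j)%N ->
  swap i j s k = (s k + (s i - s i.+1) - (s j - s j.+1))%N.
Proof. by rewrite /swap => ->. Qed.

Lemma swap_out i j s k : ~~ (i < k <= j)%N -> swap i j s k = s k.
Proof. by rewrite /swap => /negbTE ->. Qed.

Section Swap.
Variables (i j : nat) (s : nat -> nat).
Hypotheses (ij : (i < j)%N) (adms : admissible s).

Lemma swap_gapl : (swap i j s i - swap i j s i.+1 = s j - s j.+1)%N.
Proof.
rewrite swap_out ?ltnn // swap_in ?ltnSn ?ij //.
have := admissible_homo adms ij; have := admissible_homo adms (leqnSn i); lia.
Qed.

Lemma swap_gapr : (swap i j s j - swap i j s j.+1 = s i - s i.+1)%N.
Proof.
rewrite swap_in ?ij ?leqnn // swap_out ?ltnn ?andbF //.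
have := admissible_homo adms ij; have := admissible_homo adms (leqnSn j); lia.
Qed.

Lemma swapK : swap i j (swap i j s) = s.
Proof.
apply/funext => k; have [kij | kij] := boolP (i < k <= j)%N; last by rewrite !swap_out.
rewrite swap_in // swap_gapl swap_gapr swap_in //.
have [_ kj] := andP kij.
by have := admissible_homo adms kj; have := admissible_homo adms (leqnSn j); lia.
Qed.

(* Moving the larger gap to the front only lowers the sequence. *)
Lemma swap_admissible : (s i - s i.+1 <= s j - s j.+1)%N -> admissible (swap i j s).
Proof.
move=> le_ij; have [s0 sc mono] := adms; split=> [|k|k].
- by rewrite swap_out.
- have := sc k; rewrite /swap; case: ifP => // _; lia.
have sj k' : (k' <= j)%N -> (s j <= s k')%N by apply: admissible_homo.
have := mono k; have := mono j; have := mono i; rewrite /swap.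
have [->|neqi] := eqVneq k i.
  by rewrite ltnn ltnSn ij /=; have := sj _ ij; lia.
have [->|neqj] := eqVneq k j.
  by rewrite ij ltnn leqnn andbF /=; lia.
have -> : (i < k.+1 <= j)%N = (i < k <= j)%N by lia.
by case: ifP => // /andP[ik kj]; have := sj _ kj; lia.
Qed.

End Swap.

Definition blocked (i j : nat) (s : nat -> nat) : bool :=
  ~~ `[< admissible (swap i j s) >].

Lemma blocked_gap i j s : (i < j)%N -> admissible s -> blocked i j s ->
  gap j s <= gap i s.
Proof.
move=> ij adms bl; rewrite -!natr_gap // ler_nat.
by apply: contraNT bl; rewrite -ltnNge => /ltnW le; apply/asboolP/swap_admissible.
Qed.

(** Extended by the identity on blocked sequences, the exchange is an involution of the admissible
    sequences, hence measure preserving. *)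
Lemma Ex_swap i j F : (i < j)%N ->
  Ex (fun s => (~~ blocked i j s)%:R * (F (swap i j s) - F s)) = 0.
Proof.
move=> ij; pose M s := if blocked i j s then s else swap i j s.
have admM s : admissible s -> admissible (M s).
  by rewrite /M; case: ifP => // /negbFE/asboolP.
have MK s : admissible s -> M (M s) = s.
  rewrite /M => adms; case E: (blocked i j s); first by rewrite E.
  by rewrite /blocked swapK //; case: asboolP.
have <- : Ex (fun s => F (M s)) - Ex F = 0.
  rewrite Ex_move ?subrr // => s t adms admt eqM.
  by rewrite -[s]MK // eqM MK.
rewrite -ExB; apply: Ex_eq => s _; rewrite /M.
by case: ifP => _ /=; rewrite ?mul0r ?mul1r ?subrr.
Qed.

Lemma gap_swapl i j s : (i < j)%N -> admissible s -> ~~ blocked i j s ->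
  gap i (swap i j s) = gap j s.
Proof.
by move=> ij adms /negPn/asboolP admw; rewrite -!natr_gap // swap_gapl.
Qed.

(** On unblocked sequences the two gaps trade places and their contributions cancel. On the
    remaining ones [gap j <= gap i], which yields the monotonicity in k of the gap moments. *)
Lemma Ex_gap_exchange i j (psi : R -> R) : (i < j)%N ->
  Ex (fun s => psi (gap i s)) - Ex (fun s => psi (gap j s))
  = Ex (fun s => (blocked i j s)%:R * (psi (gap i s) - psi (gap j s))).
Proof.
move=> ij; have := Ex_swap (fun s => psi (gap i s)) ij.
move=> E; rewrite -ExB -[LHS]addr0 -{}E -ExD; apply: Ex_eq => s adms.
case: (boolP (blocked i j s)) => bl /=; first by ring.
by rewrite gap_swapl //; ring.
Qed.

Lemma Ex_gap_le i j : (i <= j)%N -> Ex (gap j) <= Ex (gap i).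
Proof.
rewrite leq_eqVlt => /predU1P[-> // | ij].
rewrite -subr_ge0 (Ex_gap_exchange id) //; apply: Ex_ge0 => s adms.
case: (boolP (blocked i j s)) => bl /=; last by rewrite mul0r.
by rewrite mul1r subr_ge0 blocked_gap.
Qed.

Definition gap2 (k : nat) : R := Ex (fun s => gap k s ^+ 2).

(** For u >= v >= 0 one has [(u - v) ^ 2 <= u ^ 2 - v ^ 2]. Nearly equal second moments thus make
    the blocked exchanges negligible in mean square. *)
Lemma blocked_sqr i j : (i < j)%N ->
  Ex (fun s => (blocked i j s)%:R * (gap i s - gap j s) ^+ 2) <= gap2 i - gap2 j.
Proof.
move=> ij; rewrite (Ex_gap_exchange (fun x => x ^+ 2)) //.
apply: Ex_le => s adms.
case: (boolP (blocked i j s)) => bl /=; last by rewrite !mul0r.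
by have := blocked_gap ij adms bl; have := gap_ge0 j adms; nra.
Qed.

Lemma gap2_le i j : (i <= j)%N -> gap2 j <= gap2 i.
Proof.
rewrite leq_eqVlt => /predU1P[-> // | ij]; rewrite -subr_ge0.
apply: le_trans (blocked_sqr ij); apply: Ex_ge0 => s _.
by rewrite mulr_ge0 ?sqr_ge0 // ler0n.
Qed.

(** An unblocked exchange adds [gap i s - gap j s] to [s k]; the bracket is the resulting increment
    of the square of [s k - m]. *)
Lemma Ex_swap_sqr i j k m : (i < k <= j)%N ->
  Ex (fun s => (~~ blocked i j s)%:R
    * ((gap i s - gap j s) ^+ 2 + 2 * ((s k)%:R - m) * (gap i s - gap j s))) = 0.
Proof.
move=> kij; have ij : (i < j)%N by have /andP[ik] := kij; exact: leq_trans.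
rewrite -[RHS](Ex_swap (fun s => ((s k)%:R - m) ^+ 2) ij).
apply: Ex_eq => s adms; congr (_ * _); rewrite swap_in //.
rewrite natrB ?natrD ?natr_gap //; first by ring.
have [_ kj] := andP kij.
by have := admissible_homo adms kj; lia.
Qed.

(** * Resampling a single value *)

(* The values of [s k] compatible with the rest of [s] are those between
   [s k.+1] and [upper s k]; given the rest, [s k] is uniform on them. *)
Definition upper (s : nat -> nat) (k : nat) : nat := minn (s k.-1) (c k).

Definition update (k : nat) (v : nat) (s : nat -> nat) : nat -> nat :=
  fun i => if i == k then v else s i.

Lemma admissible_update k v s : (0 < k)%N -> admissible s ->
  (s k.+1 <= v <= upper s k)%N -> admissible (update k v s).
Proof.
move=> k0 [s0 sc mono]; rewrite /upper leq_min => /and3P[le1 le2 le3].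
split=> [|i|i]; rewrite /update.
- by case: eqP => // k_0; rewrite -k_0 in k0.
- by case: eqP => [-> //|_].
case: eqP => [ik|_]; first by case: eqP => [ik'|_]; [lia | rewrite -ik /= in le2].
by case: eqP => [->|_].
Qed.

Lemma admissible_upper k s : (0 < k)%N -> admissible s ->
  (s k.+1 <= s k <= upper s k)%N.
Proof.
by case: k => // k _ [_ sc mono]; rewrite /upper leq_min /= mono mono sc.
Qed.

Definition resample (phi : nat -> nat -> nat -> nat) (k : nat) (s : nat -> nat) :=
  update k (phi (s k.+1) (upper s k) (s k)) s.

Section Resample.
Variables (phi : nat -> nat -> nat -> nat) (k : nat).
Hypothesis k_gt0 : (0 < k)%N.
Hypothesis phi_itv : forall l u v, (l <= v <= u)%N -> (l <= phi l u v <= u)%N.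
Hypothesis phi_inj : forall l u v w, (l <= v <= u)%N -> (l <= w <= u)%N ->
  phi l u v = phi l u w -> v = w.

Lemma resample_admissible s : admissible s -> admissible (resample phi k s).
Proof.
by move=> adms; apply: admissible_update => //; apply/phi_itv/admissible_upper.
Qed.

Lemma resample_inj s t : admissible s -> admissible t ->
  resample phi k s = resample phi k t -> s = t.
Proof.
move=> adms admt eqst.
have E i : i != k -> s i = t i.
  by move=> /negbTE ik; have := congr1 (@^~ i) eqst; rewrite /resample /update ik.
have Eu : upper s k = upper t k by rewrite /upper E //; lia.
apply/funext => i; have [->|/E //] := eqVneq i k.
have := congr1 (@^~ k) eqst; rewrite /resample /update eqxx Eu E ?neq_ltn ?ltnSn ?orbT //.
apply: phi_inj; last exact: admissible_upper.
by rewrite -Eu -E ?neq_ltn ?ltnSn ?orbT //; apply: admissible_upper.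
Qed.

End Resample.

Definition reflect_in (l u v : nat) : nat := (l + u - v)%N.

(** A cyclic shift by half the number of points. A reflection may fix the midpoint; this map moves
    every v by at least half of v - l, which for [s k] is half of its gap. *)
Definition rotate_in (l u v : nat) : nat :=
  let q := ((u - l).+1)./2 in if (v + q <= u)%N then (v + q)%N else (v + q - (u - l).+1)%N.

Lemma rotate_in_itv l u v : (l <= v <= u)%N -> (l <= rotate_in l u v <= u)%N.
Proof. by rewrite /rotate_in /=; case: ifP; lia. Qed.

Lemma rotate_in_inj l u v w : (l <= v <= u)%N -> (l <= w <= u)%N ->
  rotate_in l u v = rotate_in l u w -> v = w.
Proof. by rewrite /rotate_in /=; case: ifP; case: ifP; lia. Qed.

Lemma rotate_in_far l u v : (l <= v <= u)%N ->
  ((v - l)%:R / 2) ^+ 2 <= ((rotate_in l u v)%:R - v%:R) ^+ 2 :> R.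
Proof.
move=> lvu; have lv : (l <= v)%N by case/andP: lvu.
have : (2 * v + (v - l) <= 2 * rotate_in l u v)%N
    \/ (2 * rotate_in l u v + (v - l) <= 2 * v)%N.
  by move: lvu; rewrite /rotate_in /=; case: ifP; lia.
have : 0 <= (v - l)%:R :> R by rewrite ler0n.
move: (rotate_in l u v) (v - l)%N => w d d0 [].
  by rewrite -(ler_nat R) natrD !natrM; nra.
by rewrite -(ler_nat R) natrD !natrM; nra.
Qed.

Lemma reflect_in_itv l u v : (l <= v <= u)%N -> (l <= reflect_in l u v <= u)%N.
Proof. by rewrite /reflect_in; lia. Qed.

Lemma reflect_in_inj l u v w : (l <= v <= u)%N -> (l <= w <= u)%N ->
  reflect_in l u v = reflect_in l u w -> v = w.
Proof. by rewrite /reflect_in; lia. Qed.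

(** Rotating [s k] moves it by at least half of [gap k], and G registers the move. The constant is 4
    from [Ex_sqr_move] times 4 from squaring the half. *)
Lemma gap2_le_Ex_sqr (k : nat) (G : (nat -> nat) -> R) : (0 < k)%N ->
    (forall s, admissible s -> let s' := resample rotate_in k s in
       ((s' k)%:R - (s k)%:R) ^+ 2 <= (G s' - G s) ^+ 2) ->
  gap2 k <= 16 * Ex (fun s => G s ^+ 2).
Proof.
move=> k0 leG.
have : Ex (fun s => (gap k s / 2) ^+ 2) <= 4 * Ex (fun s => G s ^+ 2).
  apply: (Ex_sqr_move (M := resample rotate_in k)).
  - exact: (resample_admissible k0 rotate_in_itv).
  - exact: (resample_inj k0 rotate_in_inj).
  move=> s adms; apply: le_trans (leG s adms).
  rewrite /resample /update eqxx -natr_gap //.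
  by apply: rotate_in_far; apply: admissible_upper.
have -> : Ex (fun s => (gap k s / 2) ^+ 2) = 4^-1 * gap2 k.
  by rewrite -ExZ; apply: Ex_eq => s _; field.
lra.
Qed.

Lemma gap2_le_variance k : (0 < k)%N -> gap2 k <= 16 * variance k.
Proof.
move=> k0; apply: gap2_le_Ex_sqr => // s _ /=.
by have -> : forall x y z : R, x - z - (y - z) = x - y by move=> *; ring.
Qed.

(** Moving [s j] changes [gap i - gap j] by the same amount up to sign, or by twice that amount when
    j = i + 1. *)
Lemma gap2_le_Ex_diff i j : (i < j)%N ->
  gap2 j <= 16 * Ex (fun s => (gap i s - gap j s) ^+ 2).
Proof.
move=> ij; apply: gap2_le_Ex_sqr => [|s _ /=]; first by case: j ij.
rewrite /gap /resample /update !eqxx (ltn_eqF ij) (gtn_eqF (ltnSn j)).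
move: (rotate_in _ _ _) => v; case: ifP => [/eqP-> | _].
  by have := sqr_ge0 (v%:R - (s j)%:R : R); nra.
by rewrite le_eqVlt; apply/orP; left; apply/eqP; ring.
Qed.

(** * Lower bounds for mean gaps *)

Section Slope.
Variables (b k0 : nat).
Hypothesis c_ge : forall k, (k <= k0)%N -> (b <= c k)%N.

Let a (k : nat) : R := Ex (fun s => (minn (s k) b)%:R).

(** Averaging with the reflected value replaces [s k] by two points of its interval with the same
    sum as the endpoints, and truncation at b is concave. As [b <= c k], the upper endpoint and
    [s k.-1] have the same truncation. *)
Lemma Ex_minn_concave k : (0 < k < k0.+1)%N -> a k.-1 + a k.+1 <= 2 * a k.
Proof.
move=> /andP[k_gt0 kk0]; have bc := c_ge kk0.
pose M := resample reflect_in k.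
have E : Ex (fun s => (minn (M s k) b)%:R) = a k.
  apply: (Ex_move (fun s => (minn (s k) b)%:R)) => [s|s t].
    exact: (resample_admissible k_gt0 reflect_in_itv).
  exact: (resample_inj k_gt0 reflect_in_inj).
have -> : 2 * a k = a k + Ex (fun s => (minn (M s k) b)%:R) by rewrite E; ring.
rewrite -!ExD; apply: Ex_le => s adms.
rewrite -!natrD ler_nat /M /resample /update eqxx /reflect_in.
by have := admissible_upper k_gt0 adms; rewrite /upper; lia.
Qed.

(** The truncated means start at b and are nonnegative at [k0.+1], and truncation only lowers
    [s k]. *)
Lemma mean_ge_chord k : (k <= k0)%N ->
  (k0.+1%:R - k%:R) * b%:R <= k0.+1%:R * mean k.
Proof.
move=> kk0; have := concave_chord Ex_minn_concave (leqW kk0).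
have -> : a 0%N = b%:R.
  rewrite /a -[RHS]Ex_cst; apply: Ex_eq => s [-> _ _].
  by rewrite (minn_idPr (c_ge (leq0n _))).
have : 0 <= k%:R * a k0.+1.
  by rewrite mulr_ge0 ?ler0n //; apply: Ex_ge0 => s _; rewrite ler0n.
have : k0.+1%:R * a k <= k0.+1%:R * mean k.
  rewrite ler_pM2l ?ltr0n //; apply: Ex_le => s _.
  by rewrite ler_nat geq_minl.
by rewrite natrB ?leqW //; lra.
Qed.

End Slope.

Lemma Ex_gap k : Ex (gap k) = mean k - mean k.+1.
Proof. by rewrite /gap ExB. Qed.

Lemma mean_le_c k : mean k <= (c k)%:R.
Proof.
by rewrite -[leRHS]Ex_cst; apply: Ex_le => s [_ sc _]; rewrite ler_nat.
Qed.

Lemma mean_drop k j : mean k - mean (k + j)%N <= j%:R * Ex (gap k).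
Proof.
elim: j => [|j IH]; first by rewrite addn0 subrr mul0r.
have := Ex_gap_le (leq_addr j k); rewrite (Ex_gap (k + j)) addnS -natr1; lra.
Qed.

(** The chord bounds [mean k] from below and the ceiling bounds [mean J] from above; since mean gaps
    decrease, the drop between is at most J - k times the first of them. *)
Lemma Ex_gap_ge b k0 k J : (forall k, (k <= k0)%N -> (b <= c k)%N) ->
    (k <= k0)%N -> (k <= J)%N ->
  (k0.+1%:R - k%:R) * b%:R
    <= k0.+1%:R * ((J%:R - k%:R) * Ex (gap k) + (c J)%:R).
Proof.
move=> c_ge kk0 kJ; have := mean_ge_chord c_ge kk0.
have := mean_drop k (J - k); rewrite subnKC // natrB // => drop chord.
apply: le_trans chord _; rewrite ler_pM2l ?ltr0n //.
by have := mean_le_c J; lra.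
Qed.

Lemma Ex_gap_sqr_le k : Ex (gap k) ^+ 2 <= gap2 k.
Proof. exact: Ex_sqr_ge. Qed.

(** * Small variances at three indices *)

Definition centered (k : nat) (s : nat -> nat) : R := (s k)%:R - mean k.

Lemma Ex_centered_cst k x : Ex (fun s => centered k s * x) = 0.
Proof.
have -> : Ex (fun s => centered k s * x) = Ex (fun s => x * (s k)%:R - x * mean k).
  by apply: Ex_eq => s _; rewrite /centered; ring.
by rewrite ExB ExZ Ex_cst subrr.
Qed.

(** By [Ex_swap_sqr] with m the mean, only blocked sequences contribute to the mean of D ^ 2 + 2 q
    D, where D is the gap difference and q is [centered k]. There 2 q D is at most theta q ^ 2 + D ^
    2 / theta, and the blocked mean of D ^ 2 is at most eps. *)
Lemma Ex_diff_sqr_le i j k theta eps : (i < k <= j)%N -> 0 < theta ->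
    gap2 i - gap2 j <= eps ->
  Ex (fun s => (gap i s - gap j s) ^+ 2)
    <= eps + eps / theta + theta * variance k
       - 2 * Ex (fun s => centered k s * (gap i s - gap j s)).
Proof.
move=> kij theta0 le_eps; have ij : (i < j)%N.
  by have /andP[ik] := kij; exact: leq_trans.
have := Ex_swap_sqr (mean k) kij.
set d := fun s => gap i s - gap j s; set bl := fun s => (blocked i j s)%:R : R => E0.
have : Ex (fun s => bl s * d s ^+ 2) <= eps by apply: le_trans le_eps; exact: blocked_sqr.
set Bd := Ex _ => leBd.
have leBd' : theta^-1 * Bd <= eps / theta by rewrite mulrC ler_pM2r ?invr_gt0.
suff : Ex (fun s => d s ^+ 2) <= Ex (fun s => bl s * d s ^+ 2
  + (theta^-1 * (bl s * d s ^+ 2) + theta * ((s k)%:R - mean k) ^+ 2)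
  - 2 * (centered k s * d s)).
  rewrite ExB !ExD !ExZ -/Bd -/(variance k); lra.
rewrite -[leRHS]addr0 -E0 -ExD; apply: Ex_le => s adms.
rewrite /d /centered /bl; move: (gap i s - gap j s) ((s k)%:R - mean k) => D q.
case: (blocked i j s) => /=; last first.
  have := sqr_ge0 q; nra.
have : 0 <= theta^-1 * (theta * q - D) ^+ 2.
  by rewrite mulr_ge0 ?sqr_ge0 // invr_ge0 ltW.
have -> : theta^-1 * (theta * q - D) ^+ 2
   = theta * q ^+ 2 - 2 * (q * D) + theta^-1 * D ^+ 2.
  by field; rewrite gt_eqF.
lra.
Qed.

Lemma sum_gap s i j : (i <= j)%N ->
  \sum_(i <= k < j) gap k s = (s i)%:R - (s j)%:R.
Proof.
move=> ij; rewrite -[RHS]opprB -(telescope_sumr (fun k => (s k)%:R) ij) -sumrN.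
by apply: eq_bigr => k _; rewrite opprB.
Qed.

(* Sum [Ex_diff_sqr_le] over k1 <= i < k2 <= j < k3: the cross terms add up to
   the covariance of [s k2] with a combination of [s k1], [s k2], [s k3]. *)
Lemma three_small_variances k1 k2 k3 x eps theta Lam :
    (0 < k1)%N -> (k1 < k2)%N -> (k2 < k3)%N -> 0 < theta ->
    variance k1 <= Lam -> variance k2 <= Lam -> variance k3 <= Lam ->
    (forall j, (j < k3)%N -> 16 * x <= gap2 j) -> gap2 k1 - gap2 k3 <= eps ->
  (k2 - k1)%:R * (k3 - k2)%:R * (x - eps - eps / theta - theta * Lam)
    <= 4 * (k3 - k1)%:R * Lam.
Proof.
move=> k1_gt0 k12 k23 theta0 V1 V2 V3 gap2_ge le_eps.
pose dd i j s := centered k2 s * (gap i s - gap j s).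
have step i j : (k1 <= i < k2)%N -> (k2 <= j < k3)%N ->
    x - eps - eps / theta - theta * Lam <= - 2 * Ex (dd i j).
  move=> /andP[k1i ik2] /andP[k2j jk3].
  have le_ij : gap2 i - gap2 j <= eps.
    by have := gap2_le k1i; have := gap2_le (ltnW jk3); lra.
  have kij : (i < k2 <= j)%N by rewrite ik2.
  have := Ex_diff_sqr_le kij theta0 le_ij.
  have := gap2_le_Ex_diff (leq_trans ik2 k2j); have := gap2_ge j jk3.
  have : theta * variance k2 <= theta * Lam by rewrite ler_pM2l.
  rewrite -/(dd i j); lra.
have : \sum_(k1 <= i < k2) \sum_(k2 <= j < k3) (x - eps - eps / theta - theta * Lam)
    <= \sum_(k1 <= i < k2) \sum_(k2 <= j < k3) (- 2 * Ex (dd i j)).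
  rewrite !big_nat; apply: ler_sum => i ?.
  by rewrite !big_nat; apply: ler_sum => j ?; apply: step.
rewrite !sumr_const_nat -mulrnA -[_ *+ _]mulr_natl mulnC natrM => le1.
apply: le_trans le1 _.
under eq_bigr do rewrite -mulr_sumr -Ex_sum.
rewrite -mulr_sumr -Ex_sum.
set r1 := (k2 - k1)%:R : R; set r2 := (k3 - k2)%:R : R.
have r1_ge0 : 0 <= r1 by rewrite ler0n.
have r2_ge0 : 0 <= r2 by rewrite ler0n.
have -> : (k3 - k1)%:R = r1 + r2 :> R by rewrite -natrD; congr _%:R; lia.
pose q := centered.
have -> : Ex (fun s => \sum_(k1 <= i < k2) \sum_(k2 <= j < k3) dd i j s)
  = Ex (fun s => r2 * (q k2 s * q k1 s) + r1 * (q k2 s * q k3 s)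
                 - (r1 + r2) * q k2 s ^+ 2).
  (* The sum produces uncentred [s k1], [s k2], [s k3]; recentring them costs a constant multiple of
     [centered k2], of mean zero. *)
  have C0 := Ex_centered_cst k2 (r2 * (mean k1 - mean k2) - r1 * (mean k2 - mean k3)).
  rewrite -[RHS]addr0 -[X in _ = _ + X]C0 -ExD; apply: Ex_eq => s _.
  have -> : \sum_(k1 <= i < k2) \sum_(k2 <= j < k3) dd i j s
    = \sum_(k1 <= i < k2) centered k2 s * (gap i s * r2 - ((s k2)%:R - (s k3)%:R)).
    apply: eq_bigr => i _; rewrite -mulr_sumr; congr (_ * _).
    by rewrite sumrB sumr_const_nat sum_gap ?(ltnW k23) // mulr_natr.
  rewrite -mulr_sumr sumrB -mulr_suml sum_gap ?(ltnW k12) // sumr_const_nat.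
  by rewrite -[X in _ - X]mulr_natr -/r1 /q /centered; ring.
rewrite ExB !ExD !ExZ.
have cov i j : variance i <= Lam -> variance j <= Lam ->
    - 2 * Ex (fun s => q i s * q j s) <= 2 * Lam.
  move=> Vi Vj; have : 0 <= Ex (fun s => (q i s + q j s) ^+ 2).
    by apply: Ex_ge0 => s _; apply: sqr_ge0.
  have -> : Ex (fun s => (q i s + q j s) ^+ 2)
    = Ex (fun s => q i s ^+ 2 + q j s ^+ 2 + 2 * (q i s * q j s)).
    by apply: Ex_eq => s _; ring.
  rewrite !ExD ExZ -/(variance i) -/(variance j); lra.
have := cov _ _ V2 V1; have := cov _ _ V2 V3; rewrite -/(variance k2); nra.
Qed.

Lemma gap2_ge0 k : 0 <= gap2 k.
Proof. by apply: Ex_ge0 => s _; apply: sqr_ge0. Qed.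

(** * Few indices have small variance *)

(** The list z is cut into M blocks of 2 r steps. The first, middle and last entries of a block are
    at least r apart, and a well-chosen block is fed to [three_small_variances]. *)
Lemma spread_small_variances (z : seq nat) (kmax r M : nat) (x theta Lam : R) :
    sorted ltn z -> {in z, forall k, (0 < k <= kmax)%N /\ variance k <= Lam} ->
    (forall j, (j < kmax)%N -> 16 * x <= gap2 j) -> 0 < theta -> 0 < Lam ->
    (0 < r)%N -> (0 < M)%N -> (2 * r * M < size z)%N ->
  r%:R ^+ 2 * (M%:R * (x - theta * Lam) - 32 * Lam * (1 + theta^-1))
    <= 8 * kmax%:R * Lam.
Proof.
move=> z_sorted z_small gap2_ge theta0 Lam0 r0 M0 rM.
pose k t := nth 0%N z (2 * r * t)%N.
have z_nth i : (i < size z)%N ->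
    (0 < nth 0%N z i <= kmax)%N /\ variance (nth 0%N z i) <= Lam.
  by move=> lt; apply/z_small/mem_nth.
have in_range t : (t <= M)%N -> (2 * r * t < size z)%N.
  by move=> tM; apply: leq_ltn_trans rM; rewrite leq_mul2l tM orbT.
have kmax0 : (0 < kmax)%N.
  by have [/andP[lt0 le] _] := z_nth _ (in_range 0%N isT); apply: leq_trans le.
have kmaxR : 0 < kmax%:R :> R by rewrite ltr0n.
(* Both terms increase with t, each by at most 1 in total, the second because [gap2 <= 16 * Lam] at
   the entries of z. A block of small increment is therefore both short and of small drop in
   [gap2]. *)
pose f t : R := (k t)%:R / kmax%:R - gap2 (k t) / (16 * Lam).
have fM : f M - f 0%N <= 2.
  have [/andP[_ kM] _] := z_nth _ (in_range M (leqnn _)).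
  have [/andP[k0 _] V0] := z_nth _ (in_range 0%N isT).
  have : (k M)%:R / kmax%:R <= 1 :> R by rewrite ler_pdivrMr // mul1r ler_nat.
  have : 0 <= (k 0%N)%:R / kmax%:R :> R by rewrite divr_ge0 ?ler0n.
  have : gap2 (k 0%N) / (16 * Lam) <= 1.
    rewrite ler_pdivrMr ?mul1r ?mulr_gt0 //; have := gap2_le_variance k0.
    by rewrite -/(k 0%N); move: V0; rewrite -/(k 0%N); lra.
  have : 0 <= gap2 (k M) / (16 * Lam).
    by rewrite divr_ge0 ?gap2_ge0 ?mulr_ge0 // ltW.
  by rewrite /f; lra.
have [t tM] := telescope_pigeonhole M0 fM.
have nth_far i j : (i + j < size z)%N -> (nth 0%N z i + j <= nth 0%N z (i + j))%N.
  elim: j => [|j IH]; rewrite ?addn0 // !addnS => lt.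
  apply: leq_ltn_trans (IH (ltnW lt)) _.
  by apply: (sorted_ltn_nth ltn_trans) => //; rewrite inE // ltnW.
have rt1 := in_range _ tM.
have E3 : (2 * r * t.+1 = 2 * r * t + r + r)%N by rewrite mulnS; lia.
pose k2 := nth 0%N z (2 * r * t + r)%N.
have lt2 : (2 * r * t + r < size z)%N by apply: leq_ltn_trans rt1; rewrite E3; lia.
have far1 : (k t + r <= k2)%N by apply: nth_far.
have far2 : (k2 + r <= k t.+1)%N by rewrite /k E3; apply: nth_far; rewrite -E3.
have [/andP[k1_gt0 _] V1] := z_nth _ (in_range _ (ltnW tM)).
have [_ V2] := z_nth _ lt2.
have [/andP[_ k3_max] V3] := z_nth _ rt1.
have k12 : (k t < k2)%N by apply: leq_trans far1; rewrite -addn1 leq_add2l.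
have k23 : (k2 < k t.+1)%N by apply: leq_trans far2; rewrite -addn1 leq_add2l.
have gap2_ge3 j : (j < k t.+1)%N -> 16 * x <= gap2 j.
  by move=> lt; apply: gap2_ge; apply: leq_trans lt k3_max.
set eps := gap2 (k t) - gap2 (k t.+1).
have eps0 : 0 <= eps.
  by rewrite subr_ge0 gap2_le // ltnW // (ltn_trans k12).
have := three_small_variances k1_gt0 k12 k23 theta0 V1 V2 V3 gap2_ge3 (lexx eps).
set Q := (k t.+1 - k t)%:R : R.
have Q0 : 0 <= Q by rewrite ler0n.
have -> : f t.+1 - f t = Q / kmax%:R + eps / (16 * Lam).
  by rewrite /f /Q /eps natrB ?(ltnW (ltn_trans k12 k23)) //; ring.
have MR : 0 < M%:R :> R by rewrite ltr0n.
move=> three; rewrite mulrDr => le2.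
have Qmax : 0 <= Q / kmax%:R by rewrite divr_ge0 // ltW.
have epsLam : 0 <= eps / (16 * Lam) by rewrite divr_ge0 // mulr_ge0 // ltW.
have MQ : M%:R * Q <= 2 * kmax%:R.
  rewrite -ler_pdivrMr // -mulrA.
  by have := mulr_ge0 (ltW MR) epsLam; lra.
have Meps : M%:R * eps <= 32 * Lam.
  have -> : 32 * Lam = 2 * (16 * Lam) by ring.
  rewrite -ler_pdivrMr ?mulr_gt0 // -mulrA.
  by have := mulr_ge0 (ltW MR) Qmax; lra.
have theta1 : 0 < 1 + theta^-1 by rewrite addr_gt0 ?invr_gt0.
apply: (@le_trans _ _ (M%:R * (r%:R ^+ 2 * (x - eps - eps / theta - theta * Lam)))).
  rewrite mulrCA; apply: ler_wpM2l; first exact: sqr_ge0.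
  have : M%:R * eps * (1 + theta^-1) <= 32 * Lam * (1 + theta^-1) by rewrite ler_pM2r.
  lra.
apply: (@le_trans _ _ (M%:R * (4 * Q * Lam))); last first.
  have -> : M%:R * (4 * Q * Lam) = 4 * (M%:R * Q) * Lam by ring.
  by rewrite ler_pM2r //; lra.
rewrite ler_pM2l //; set D := _ - theta * Lam in three *.
(* Only for D >= 0 may the two distances be replaced by their lower bound r; for D < 0 the left side
   is already nonpositive. *)
have [D0 | /ltW D0] := leP 0 D; last first.
  apply: (@le_trans _ _ 0); last by rewrite !mulr_ge0 // ltW.
  by rewrite mulr_ge0_le0 ?sqr_ge0.
apply: le_trans three; apply: ler_wpM2r => //; rewrite expr2 -!natrM ler_nat.
apply: leq_mul; first by rewrite -(leq_add2l (k t)) subnKC ?(ltnW k12).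
by rewrite -(leq_add2l k2) subnKC ?(ltnW k23).
Qed.

(** Otherwise there are M > M0 blocks. With theta = x / (4 Lam) the errors use up at most half of M
    x, so r ^ 2 M x / 2 <= 8 kmax Lam; since nu kmax <= size z <= 4 r M, this contradicts the size
    of r. *)
Lemma size_small_variances (z : seq nat) (kmax r M0 : nat) (nu x Lam : R) :
    sorted ltn z -> {in z, forall k, (0 < k <= kmax)%N /\ variance k <= Lam} ->
    (forall j, (j < kmax)%N -> 16 * x <= gap2 j) ->
    0 < nu -> 0 < x -> 0 < Lam -> nu * kmax%:R <= (size z)%:R ->
    64 * Lam < r%:R * x * nu -> 128 * Lam * (1 + 4 * Lam / x) <= M0%:R * x ->
  (size z < 4 * r * M0.+1)%N.
Proof.
move=> z_sorted z_small gap2_ge nu0 x0 Lam0 kmax_le r_large M0_large.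
rewrite ltnNge; apply/negP => size_ge.
have r0 : (0 < r)%N.
  by case: r r_large {size_ge} => //; rewrite !mul0r; lra.
(* The predecessor keeps the last block end, at position 2 r M, inside z. *)
pose M := ((size z).-1 %/ (2 * r))%N.
have divE := divn_eq (size z).-1 (2 * r).
have modlt : ((size z).-1 %% (2 * r) < 2 * r)%N by rewrite ltn_mod muln_gt0.
have size0 : (0 < size z)%N by apply: leq_trans size_ge; rewrite !muln_gt0 r0.
have [M_ge rM size_le] :
    [/\ (M0.+1 <= M)%N, (2 * r * M < size z)%N & (size z <= 4 * r * M)%N].
  have M_ge : (M0.+1 <= M)%N.
    rewrite leq_divRL ?muln_gt0 //; move: size_ge r0; clear; nia.
  split=> //; first by rewrite mulnC; move: divE size0; rewrite -/M; clear; lia.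
  have : (2 * r <= M * (2 * r))%N by rewrite leq_pmull // (leq_trans _ M_ge).
  by move: divE modlt size0; rewrite -/M; clear; nia.
have M_gt0 : (0 < M)%N by apply: leq_trans M_ge.
have theta0 : 0 < x / (4 * Lam) by rewrite divr_gt0 // mulr_gt0.
have := spread_small_variances z_sorted z_small gap2_ge theta0 Lam0 r0 M_gt0 rM.
have -> : x / (4 * Lam) * Lam = x / 4 by field; rewrite gt_eqF.
have -> : (x / (4 * Lam))^-1 = 4 * Lam / x by field; rewrite !gt_eqF.
apply/negP; rewrite -ltNge.
have MM0 : M0%:R * x <= M%:R * x by rewrite ler_pM2r // ler_nat ltnW.
have MR : 0 < M%:R :> R by rewrite ltr0n.
have rR : 0 < r%:R :> R by rewrite ltr0n.
apply: (@lt_le_trans _ _ (r%:R ^+ 2 * (M%:R * x / 2))); last first.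
  by apply: ler_wpM2l; [apply: sqr_ge0 | lra].
rewrite -(ltr_pM2l nu0).
apply: (@le_lt_trans _ _ (32 * r%:R * M%:R * Lam)).
  have -> : nu * (8 * kmax%:R * Lam) = 8 * Lam * (nu * kmax%:R) by ring.
  have -> : 32 * r%:R * M%:R * Lam = 8 * Lam * (4 * r%:R * M%:R) by ring.
  rewrite ler_pM2l ?mulr_gt0 //; apply: le_trans kmax_le _.
  by rewrite -!natrM ler_nat.
have -> : nu * (r%:R ^+ 2 * (M%:R * x / 2)) = r%:R * M%:R / 2 * (r%:R * x * nu) by field.
have -> : 32 * r%:R * M%:R * Lam = r%:R * M%:R / 2 * (64 * Lam) by field.
by rewrite ltr_pM2l // !mulr_gt0 ?invr_gt0.
Qed.

(** * Mean gaps under the hyperbola bound *)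

Section Hyperbola.
Variables (mu : R) (a b k0 : nat).
Hypotheses (mu_gt0 : 0 < mu) (a_gt0 : (0 < a)%N) (b_gt0 : (0 < b)%N).
Hypothesis a_le_k0 : (a <= k0)%N.
Hypothesis c_ge : forall k, (k <= k0)%N -> (b <= c k)%N.
Hypothesis c_le : forall J, (0 < J)%N -> mu * (J%:R * (c J)%:R) <= a%:R * b%:R.

Lemma hyperbola_k0 : mu * k0%:R <= a%:R.
Proof.
have bR : 0 < b%:R :> R by rewrite ltr0n.
rewrite -(ler_pM2r bR) -mulrA; apply: le_trans (c_le (leq_trans a_gt0 a_le_k0)).
by rewrite ler_pM2l // ler_wpM2l ?ler0n // ler_nat c_ge.
Qed.

Lemma hyperbola_mu_le1 : mu <= 1.
Proof.
have aR : 0 < a%:R :> R by rewrite ltr0n.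
rewrite -(ler_pM2r aR) mul1r; apply: le_trans hyperbola_k0.
by rewrite ler_pM2l // ler_nat.
Qed.

(* Compare the lower bound of [mean_ge_chord] at k with the hyperbola bound at
   an index J of order k0 / mu, where c J is at most half as large. *)
Lemma hyperbola_gap k : (k <= k0 - a./2)%N ->
  mu ^+ 3 * b%:R <= 80 * a%:R * Ex (gap k).
Proof.
move=> k_le; set N : R := k0.+1%:R.
have aR : 1 <= a%:R :> R by rewrite ler1n.
have bR : 0 < b%:R :> R by rewrite ltr0n.
have mu1 := hyperbola_mu_le1.
have N0 : 0 < N by rewrite ltr0n.
have muN : mu * N <= 2 * a%:R.
  by rewrite /N -natr1 mulrDr mulr1; have := hyperbola_k0; lra.
have kk0 : (k <= k0)%N by lia.
have u_ge : a%:R <= 2 * (N - k%:R).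
  by rewrite /N -natrB ?leqW // -natrM ler_nat; lia.
(* From mu J >= 4 N the hyperbola gives N c_J <= a b / 4, half of the lower bound a b / 2 for (N -
   k) b that follows from [u_ge]. The other half is left for the gap term. *)
pose w := 4 * N / mu; pose J := (Num.truncn w).+1.
have w0 : 0 <= w by rewrite divr_ge0 ?mulr_ge0 // ltW.
have wJ : w <= J%:R by rewrite ltW // real_truncnS_gt ?ger0_real.
have Jw : J%:R <= w + 1 by rewrite /J -natr1 lerD2r truncn_le.
have muw : mu * w = 4 * N by rewrite /w; field; rewrite gt_eqF.
have muJ_ge : 4 * N <= mu * J%:R by rewrite -muw ler_pM2l.
have muJ_le : mu * J%:R <= 5 * N.
  have : mu * J%:R <= mu * (w + 1) by rewrite ler_pM2l.
  have : 1 <= N by rewrite ler1n.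
  rewrite mulrDr muw; lra.
have kJ : (k <= J)%N.
  rewrite -(ler_nat R); apply: le_trans wJ; rewrite ler_pdivlMr //.
  have : k%:R <= N by rewrite ler_nat leqW.
  have : k%:R * mu <= k%:R * 1 by rewrite ler_wpM2l ?ler0n.
  lra.
have main := Ex_gap_ge c_ge kk0 kJ.
have gap0 : 0 <= Ex (gap k) by apply: Ex_ge0 => s; apply: gap_ge0.
have cJ : 4 * (N * (c J)%:R) <= a%:R * b%:R.
  apply: le_trans (c_le (ltn0Sn _ : (0 < J)%N)).
  by rewrite !mulrA ler_wpM2r ?ler0n.
have EJ : N * ((J%:R - k%:R) * Ex (gap k)) <= N * (J%:R * Ex (gap k)).
  by rewrite ler_pM2l // ler_wpM2r // lerBlDr lerDl ler0n.
have ub : a%:R * b%:R <= 2 * ((N - k%:R) * b%:R) by rewrite mulrA ler_pM2r.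
have step1 : a%:R * b%:R <= 4 * (N * (J%:R * Ex (gap k))).
  by move: main; rewrite -/N mulrDr; lra.
have step2 : mu * (a%:R * b%:R) <= 20 * (N * N) * Ex (gap k).
  apply: (@le_trans _ _ (mu * (4 * (N * (J%:R * Ex (gap k)))))); first by rewrite ler_pM2l.
  have -> : mu * (4 * (N * (J%:R * Ex (gap k)))) = 4 * N * Ex (gap k) * (mu * J%:R) by ring.
  have -> : 20 * (N * N) * Ex (gap k) = 4 * N * Ex (gap k) * (5 * N) by ring.
  by apply: ler_wpM2l => //; apply: mulr_ge0 => //; apply: mulr_ge0 => //; apply: ltW.
have aR0 : 0 < a%:R :> R by rewrite ltr0n.
rewrite -(ler_pM2r aR0).
apply: (@le_trans _ _ (mu ^+ 2 * (20 * (N * N) * Ex (gap k)))).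
  have -> : mu ^+ 3 * b%:R * a%:R = mu ^+ 2 * (mu * (a%:R * b%:R)) by ring.
  by rewrite ler_pM2l // exprn_gt0.
have -> : mu ^+ 2 * (20 * (N * N) * Ex (gap k))
  = 20 * Ex (gap k) * ((mu * N) * (mu * N)) by ring.
have -> : 80 * a%:R * Ex (gap k) * a%:R
  = 20 * Ex (gap k) * (2 * a%:R * (2 * a%:R)) by ring.
apply: ler_wpM2l; first exact: mulr_ge0.
by apply: ler_pM => //; rewrite mulr_ge0 // ltW.
Qed.

End Hyperbola.

(** * Summing the variances *)

(** At most half of the indices exceed [kmax], and fewer than a quarter are low with variance below
    Lam. At least a quarter thus contribute Lam each, whence the factor 4. *)
Lemma sum_variance_ge (mu x Lam : R) (b k0 r M0 : nat) (ks : seq nat) :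
    uniq ks -> {in ks, forall k, (0 < k <= k0)%N} -> 0 < mu ->
    (0 < b)%N -> mu * (size ks)%:R <= b%:R ->
    (forall k, (k <= k0)%N -> (b <= c k)%N) ->
    (forall J, (0 < J)%N -> mu * (J%:R * (c J)%:R) <= (size ks)%:R * b%:R) ->
    1 <= Lam -> 0 < x -> 16 * x = (mu ^+ 4 / 80) ^+ 2 ->
    256 * Lam < r%:R * x * mu -> 128 * Lam * (1 + 4 * Lam / x) <= M0%:R * x ->
    5120 * (r * M0.+1)%:R * Lam < mu ^+ 3 * b%:R ->
  Lam * (size ks)%:R <= 4 * \sum_(k <- ks) variance k.
Proof.
move=> uks ks_le mu0 b0 ab c_ge c_le Lam1 x0 xE r_large M0_large b_large.
set a := size ks.
have Lam0 : 0 < Lam by lra.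
have variance_ge0 k : 0 <= variance k by apply: Ex_ge0 => s _; apply: sqr_ge0.
have [a0 | a_gt0] := posnP a.
  by rewrite a0 mulr0 mulr_ge0 // sumr_ge0.
have a_k0 : (a <= k0)%N.
  rewrite -[leqRHS](size_iota 1) uniq_leq_size // => k /ks_le.
  by rewrite mem_iota add1n ltnS.
pose kmax := (k0 - a./2)%N.
have gap_ge k : (k <= kmax)%N -> mu ^+ 3 * b%:R <= 80 * a%:R * Ex (gap k).
  exact: (hyperbola_gap mu0 a_gt0 b0 a_k0 c_ge c_le).
have aR : 0 < a%:R :> R by rewrite ltr0n.
(* By [mu * a <= b], the gap bound becomes [Ex (gap k) >= mu ^ 4 / 80], the origin of x. *)
have gap2_ge k : (k < kmax)%N -> 16 * x <= gap2 k.
  move=> /ltnW/gap_ge gk; apply: le_trans (Ex_gap_sqr_le k); rewrite xE.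
  apply: lerXn2r; rewrite ?nnegrE.
  - by rewrite divr_ge0 // exprn_ge0 // ltW.
  - by apply: Ex_ge0 => s; apply: gap_ge0.
  rewrite ler_pdivrMr // -(ler_pM2l aR).
  have : mu ^+ 3 * (mu * a%:R) <= mu ^+ 3 * b%:R by rewrite ler_pM2l ?exprn_gt0.
  by rewrite [mu ^+ 4]exprSr; lra.
pose low k := (k <= kmax)%N; pose bad k := low k && (variance k < Lam).
pose z := sort leq [seq k <- ks | bad k].
have z_mem k : (k \in z) = (k \in ks) && bad k by rewrite mem_sort mem_filter andbC.
have z_small : {in z, forall k, (0 < k <= kmax)%N /\ variance k <= Lam}.
  move=> k; rewrite z_mem => /and3P[/ks_le/andP[k_gt0 _] klow /ltW].
  by rewrite k_gt0.
have z_sorted : sorted ltn z.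
  by rewrite ltn_sorted_uniq_leq sort_uniq filter_uniq // sort_sorted //; exact: leq_total.
have size_z : size z = count bad ks by rewrite size_sort size_filter.
(* If a quarter were bad, [size_small_variances] with nu = mu / 4 would bound a. A single bad index
   has mean gap at most 4 Lam, so the gap bound then bounds b as well, against [b_large]; 5120 is 80
   * 16 * 4. *)
have few : (4 * count bad ks < a)%N.
  rewrite ltnNge; apply/negP => many.
  have z0 : (0 < size z)%N by rewrite size_z; move: many a_gt0; clear; lia.
  have zlt : (size z < 4 * r * M0.+1)%N.
    apply: (@size_small_variances z kmax r M0 (mu / 4) x Lam) => //.
    - by rewrite divr_gt0.
    - have := hyperbola_k0 mu0 a_gt0 b0 a_k0 c_ge c_le.
      have : mu * kmax%:R <= mu * k0%:R by rewrite ler_pM2l // ler_nat leq_subr.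
      have : a%:R <= 4 * (size z)%:R :> R by rewrite -natrM ler_nat size_z.
      lra.
    - by rewrite mulrA ltr_pdivlMr //; lra.
  have /(mem_nth 0%N) := z0; set k := nth _ _ _; rewrite z_mem => /and3P[/ks_le].
  move=> /andP[k_gt0 _] /gap_ge gk Vk.
  have := le_trans (Ex_gap_sqr_le k) (gap2_le_variance k_gt0).
  have E0 : 0 <= Ex (gap k) by apply: Ex_ge0 => s; apply: gap_ge0.
  set E := Ex (gap k) in gk E0 * => EV.
  (* From E ^ 2 <= 16 Lam, using Lam >= 1. *)
  have E4 : E <= 4 * Lam.
    rewrite leNgt; apply/negP => lt.
    have : 4 * Lam * (4 * Lam) < E * E by apply: ltr_pM => //; rewrite mulr_ge0 // ltW.
    have : Lam * 1 <= Lam * Lam by rewrite ler_pM2l.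
    by move: EV Vk; rewrite expr2; lra.
  have a_small : a%:R <= 16 * (r * M0.+1)%:R :> R.
    by rewrite -natrM ler_nat; move: many zlt; rewrite -size_z -mulnA; clear; lia.
  have : 80 * a%:R * E <= 80 * (16 * (r * M0.+1)%:R) * (4 * Lam).
    by apply: ler_pM => //; [rewrite mulr_ge0 // ltW | rewrite ler_pM2l].
  lra.
have many_low : (a <= count low ks + a./2)%N.
  rewrite -[leqLHS](count_predC low) leq_add2l -size_filter.
  rewrite -[leqRHS](size_iota kmax.+1).
  apply: uniq_leq_size => [|k]; first exact: filter_uniq.
  rewrite mem_filter mem_iota /= -ltnNge => /andP[lowk /ks_le]; rewrite /kmax.
  by move: lowk; rewrite /low /kmax; clear; lia.
pose good k := low k && ~~ (variance k < Lam).
have split_low : count low ks = (count bad ks + count good ks)%N.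
  rewrite -(size_filter low) -(count_predC (fun k => variance k < Lam)) !count_filter.
  by congr addn; apply: eq_count => k; rewrite /= andbC.
have good_sum : Lam * (count good ks)%:R <= \sum_(k <- ks) variance k.
  rewrite -sum1_count natr_sum mulr_sumr [leRHS](bigID good) /=.
  apply: ler_wpDr; first exact: sumr_ge0.
  by apply: ler_sum => k /andP[_]; rewrite mulr1 -leNgt.
apply: (@le_trans _ _ (4 * (Lam * (count good ks)%:R))); last by rewrite ler_pM2l.
rewrite mulrCA ler_pM2l // -natrM ler_nat.
by move: few many_low; rewrite split_low; clear; lia.
Qed.

End UniformSequences.

(** * Linear extensions of a two-chain poset as sequences *)

Section Enumeration.
Variables (P : finType) (C : {set P}) (rho : P -> nat).
Hypothesis rho_inj : {in C &, injective rho}.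
Hypothesis rho_lt : {in C, forall z, (rho z < #|C|)%N}.

(** The elements numbered below t are at most t, the others at most [#|C| - t]; the total forces
    equality. *)
Lemma card_inj_ltn t : (t <= #|C|)%N -> #|[set z in C | (rho z < t)%N]| = t.
Proof.
have ub (D : {set P}) l u : D \subset C ->
    {in D, forall z, (l <= rho z < l + u)%N} -> (#|D| <= u)%N.
  move=> /subsetP DC Drho; rewrite cardE -(size_map rho) -[leqRHS](size_iota l).
  apply: uniq_leq_size => [|_ /mapP[z zD ->]].
    rewrite map_inj_in_uniq ?enum_uniq // => x y.
    by rewrite !mem_enum => /DC xC /DC yC; apply: rho_inj.
  by rewrite mem_iota; apply: Drho; rewrite -mem_enum.
move=> tC; set S := [set z in C | _].
have SC : S \subset C by apply/subsetP => z; rewrite inE => /andP[].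
have := cardsID S C; rewrite (setIidPr SC).
have : (#|S| <= t)%N by apply: (ub S 0%N) => // z; rewrite inE => /andP[].
have : (#|C :\: S| <= #|C| - t)%N.
  apply: (ub _ t) => [|z]; first exact: subsetDl.
  by rewrite !inE subnKC // => /andP[+ zC]; rewrite zC rho_lt // andbT -leqNgt.
lia.
Qed.

Lemma inj_ltn_onto t : (t < #|C|)%N -> exists2 z, z \in C & rho z = t.
Proof.
move=> tC; have [/exists_inP[z zC /eqP]|] := boolP [exists z in C, rho z == t].
  by exists z.
rewrite negb_exists_in => /forall_inP none.
have := card_inj_ltn tC; rewrite -[t in RHS](card_inj_ltn (ltnW tC)).
have -> : [set z in C | (rho z < t.+1)%N] = [set z in C | (rho z < t)%N].
  apply/setP => z; rewrite !inE ltnS leq_eqVlt.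
  by have [/none/negbTE -> |] := boolP (z \in C).
by move=> /eqP; rewrite ltn_eqF.
Qed.

End Enumeration.

Section Rank.
Context {d : Order.disp_t} {P : finPOrderType d}.
Implicit Types (C : {set P}) (x y z : P).

Definition rank C z : nat := #|[set w in C | (w < z)%O]|.

Lemma rank_le C x y : (x <= y)%O -> (rank C x <= rank C y)%N.
Proof.
move=> xy; apply/subset_leq_card/subsetP => z.
by rewrite !inE => /andP[-> /lt_le_trans]; apply.
Qed.

Lemma rank_lt C x y : x \in C -> (x < y)%O -> (rank C x < rank C y)%N.
Proof.
move=> xC xy; apply/proper_card/properP; split.
  by apply/subsetP => z; rewrite !inE => /andP[-> /lt_trans]; apply.
by exists x; rewrite !inE xC ?xy // ltxx.
Qed.

Lemma rank_bound C x : x \in C -> (rank C x < #|C|)%N.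
Proof.
move=> xC; apply/proper_card/properP; split.
  by apply/subsetP => z; rewrite inE => /andP[].
by exists x; rewrite // !inE ltxx andbF.
Qed.

Lemma rank_ltP C x y : is_chain C -> x \in C -> y \in C ->
  (rank C x < rank C y)%N = (x < y)%O.
Proof.
move=> chC xC yC; apply/idP/idP => [|/(rank_lt xC) //].
apply: contraTT => nlt; rewrite -leqNgt; apply: rank_le.
have := chC _ _ xC yC; case: comparableP nlt => //= [//|<-//].
Qed.

Lemma rank_inj C : is_chain C -> {in C &, injective (rank C)}.
Proof.
move=> chC x y xC yC eqr; have := chC _ _ xC yC.
have := rank_ltP chC xC yC; have := rank_ltP chC yC xC.
by rewrite eqr ltnn; case: comparableP.
Qed.

End Rank.

(** * From linear extensions to sequences *)

Section TwoChains.
Context {d : Order.disp_t} {P : finPOrderType d} (X Y : {set P}).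
Hypothesis tc : two_chain_poset X Y.

Let chX : is_chain X. Proof. by case: tc. Qed.
Let chY : is_chain Y. Proof. by case: tc. Qed.

Lemma two_chain_notX z : (z \notin X) = (z \in Y).
Proof.
have [_ _ /pred0P dis cov _] := tc.
have := dis z; have := in_setT z; rewrite -cov inE /=.
by case: (z \in X); case: (z \in Y).
Qed.

Lemma two_chain_nlt x y : x \in X -> y \in Y -> (y < x)%O = false.
Proof. by move=> xX yY; have [_ _ _ _ /(_ x y xX yY)/negbTE] := tc. Qed.

(* Elements of X are numbered from the top: the maximum of X has index 1. *)
Definition idx (x : P) : nat := (#|X| - rank X x)%N.

Lemma idx_gt0 x : x \in X -> (0 < idx x)%N.
Proof. by move=> xX; rewrite subn_gt0 rank_bound. Qed.

Lemma idx_le x : (idx x <= #|X|)%N.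
Proof. exact: leq_subr. Qed.

Lemma idx_inj : {in X &, injective idx}.
Proof.
move=> x y xX yX eqi; apply: (rank_inj chX) => //.
have := rank_bound xX; have := rank_bound yX; move: eqi; rewrite /idx; lia.
Qed.

Lemma idx_ltP x y : x \in X -> y \in X -> (idx x < idx y)%N = (y < x)%O.
Proof.
move=> xX yX; rewrite -(rank_ltP chX yX xX) /idx.
by have := rank_bound xX; have := rank_bound yX; lia.
Qed.

Lemma idx_leP x y : x \in X -> y \in X -> (idx x <= idx y)%N = (y <= x)%O.
Proof.
move=> xX yX; rewrite leqNgt idx_ltP //.
by have := chX xX yX; case: comparableP.
Qed.

Lemma idx_onto k : (0 < k <= #|X|)%N -> exists2 x, x \in X & idx x = k.
Proof.
move=> /andP[k0 kX].
have kX' : (#|X| - k < #|X|)%N by lia.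
have [x xX rx] := inj_ltn_onto (rank_inj chX) (@rank_bound _ _ X) kX'.
by exists x; rewrite // /idx rx subKn.
Qed.

(* The value is #|Y| at k = 0 and 0 for k > #|X|, so that sequences need no
   boundary conditions other than [admissible]. *)
Definition ceiling (k : nat) : nat :=
  if k == 0%N then #|Y|
  else #|[set y in Y | [exists x in X, (idx x == k) && ~~ (x < y)%O]]|.

Lemma ceiling_idx x : x \in X -> ceiling (idx x) = #|[set y in Y | ~~ (x < y)%O]|.
Proof.
move=> xX; rewrite /ceiling gtn_eqF ?idx_gt0 //.
apply: eq_card => y; rewrite !inE; congr (_ && _).
apply/exists_inP/idP => [[x' x'X /andP[/eqP/(idx_inj x'X xX) ->]] // | nxy].
by exists x; rewrite // eqxx.
Qed.

Lemma ceiling_out k : (#|X| < k)%N -> ceiling k = 0%N.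
Proof.
case: k => // k Xk; apply: eq_card0 => y; rewrite !inE; apply/negP.
by move=> /andP[_ /exists_inP[x _ /andP[/eqP ix _]]]; have := idx_le x; lia.
Qed.

Definition profile (f : {ffun P -> 'I_#|P|}) (k : nat) : nat :=
  if k == 0%N then #|Y|
  else #|[set y in Y | [exists x in X, (idx x == k) && (f y < f x)%N]]|.

Lemma profile_idx f x : x \in X ->
  profile f (idx x) = #|[set y in Y | (f y < f x)%N]|.
Proof.
move=> xX; rewrite /profile gtn_eqF ?idx_gt0 //.
apply: eq_card => y; rewrite !inE; congr (_ && _).
apply/exists_inP/idP => [[x' x'X /andP[/eqP/(idx_inj x'X xX) ->]] // | nxy].
by exists x; rewrite // eqxx.
Qed.

Local Notation linext := (@linext d P).

Lemma linext_inj f : f \in linext -> injective f.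
Proof. by rewrite inE => /andP[/injectiveP]. Qed.

Lemma linext_lt f x y : f \in linext -> (x < y)%O -> (f x < f y)%N.
Proof.
move=> fL xy; have [_ homf] := (linext_bijP f).1 fL.
rewrite ltn_neqAle homf ?ltW // andbT.
by rewrite (inj_eq val_inj) (inj_eq (linext_inj fL)) lt_eqF.
Qed.

Lemma profile_admissible f : f \in linext -> admissible ceiling (profile f).
Proof.
move=> fL; have le_ceiling k : (profile f k <= ceiling k)%N.
  rewrite /profile /ceiling; case: eqP => // _; apply/subset_leq_card/subsetP => y.
  rewrite !inE => /andP[-> /exists_inP[x xX /andP[ix fyx]]] /=.
  apply/exists_inP; exists x; rewrite // ix /=; apply/negP => /(linext_lt fL).
  by rewrite ltnNge ltnW.
split=> // k; have [-> | k_gt0] := posnP k.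
  by apply/subset_leq_card/subsetP => y; rewrite inE => /andP[].
have [kX | /ceiling_out c0] := leqP k.+1 #|X|; last first.
  by have := le_ceiling k.+1; rewrite c0 leqn0 => /eqP ->.
have [x xX ix] := @idx_onto k.+1 kX.
have [x' x'X ix'] : exists2 x, x \in X & idx x = k by apply: idx_onto; lia.
rewrite -ix -ix' !profile_idx //; apply/subset_leq_card/subsetP => y.
rewrite !inE => /andP[-> fyx] /=; apply: ltn_trans fyx (linext_lt fL _).
by rewrite -idx_ltP // ix ix'.
Qed.

(** The inverse of [profile], with positions from 0. The elements of Y before x are the first
    [s (idx x)] ones, so x precedes y exactly when this count is at most the rank of y. *)
Definition place (s : nat -> nat) (z : P) : nat :=
  if z \in X then (rank X z + s (idx z))%N
  else (rank Y z + #|[set x in X | (s (idx x) <= rank Y z)%N]|)%N.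

Lemma linext_card_lt f z : f \in linext -> #|[set w | (f w < f z)%N]| = f z.
Proof.
move=> fL.
rewrite -[RHS](@card_inj_ltn P [set: P] (fun w => f w)) ?cardsT.
- by apply: eq_card => w; rewrite !inE.
- by move=> x y _ _ /val_inj; apply: (linext_inj fL).
- by [].
- exact: ltnW.
Qed.

Lemma linext_below f C z : f \in linext -> is_chain C -> z \in C ->
  [set w in C | (f w < f z)%N] = [set w in C | (w < z)%O].
Proof.
move=> fL chC zC; apply/setP => w; rewrite !inE.
case: (boolP (w \in C)) => //= wC; apply/idP/idP => [|/(linext_lt fL) //].
have := chC _ _ wC zC; case: comparableP => // [/(linext_lt fL)/ltnW | ->].
  by rewrite leqNgt => /negbTE ->.
by rewrite ltnn.
Qed.

Lemma card_XY (Q : pred P) :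
  #|[set w | Q w]| = (#|[set w in X | Q w]| + #|[set w in Y | Q w]|)%N.
Proof.
rewrite -(cardsID X [set w | Q w]); congr (_ + _)%N; apply: eq_card => w.
  by rewrite !inE andbC.
by rewrite !inE two_chain_notX.
Qed.

Lemma linext_place f : f \in linext -> forall z, nat_of_ord (f z) = place (profile f) z.
Proof.
move=> fL z; rewrite -[LHS](linext_card_lt z fL) card_XY /place.
case: (boolP (z \in X)) => [zX | ].
  by rewrite linext_below // profile_idx.
rewrite two_chain_notX => zY; rewrite (linext_below fL chY zY) addnC.
congr (_ + _)%N; apply: eq_card => x; rewrite !inE.
case: (boolP (x \in X)) => //= xX; rewrite profile_idx //.
apply/idP/idP => [fxz | ].
  apply/subset_leq_card/subsetP => y; rewrite !inE => /andP[yY fyx].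
  rewrite yY /=; have /setP/(_ y) := linext_below fL chY zY; rewrite !inE yY /= => <-.
  exact: ltn_trans fyx fxz.
apply: contraLR; rewrite -leqNgt -ltnNge leq_eqVlt.
move=> /predU1P[/val_inj/(linext_inj fL) zx | fzx].
  by have := two_chain_notX z; rewrite zY zx xX.
apply/proper_card/properP; split; last first.
  by exists z; rewrite !inE zY ?fzx ?ltxx.
apply/subsetP => y; rewrite !inE => /andP[yY /(linext_lt fL) yz].
by rewrite yY (ltn_trans yz fzx).
Qed.

Lemma profile_inj : {in linext &, injective profile}.
Proof.
move=> f g fL gL eqfg; apply/ffunP => z; apply: val_inj => /=.
by rewrite !linext_place // eqfg.
Qed.

(** * From sequences back to linear extensions *)

Section Place.
Variable s : nat -> nat.
Hypothesis adms : admissible ceiling s.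

Lemma adm_homo i j : (i <= j)%N -> (s j <= s i)%N.
Proof. exact: admissible_homo adms. Qed.

Lemma adm_le_Y k : (s k <= #|Y|)%N.
Proof. by have [s0 _ _] := adms; rewrite -[#|Y|]s0; apply: (adm_homo (leq0n k)). Qed.

Lemma placeX x : x \in X -> place s x = (rank X x + s (idx x))%N.
Proof. by rewrite /place => ->. Qed.

Lemma placeY y : y \in Y ->
  place s y = (rank Y y + #|[set x in X | (s (idx x) <= rank Y y)%N]|)%N.
Proof. by rewrite -two_chain_notX /place => /negbTE ->. Qed.

(** As s is nonincreasing in the index, the set [D] of elements of X sent before y is a lower set of
    X. It contains x and all below it in the first case, and only elements below x in the second. *)
Lemma place_XY x y : x \in X -> y \in Y ->
  if (s (idx x) <= rank Y y)%N then (place s x < place s y)%N else (place s y < place s x)%N.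
Proof.
move=> xX yY; rewrite placeX // placeY //.
set D := [set x in X | (s (idx x) <= rank Y y)%N]; case: (leqP (s (idx x))) => sx.
  suff : (rank X x < #|D|)%N by move: sx; clear; lia.
  apply/proper_card/properP; split; last first.
    by exists x; rewrite !inE xX ?sx ?ltxx.
  apply/subsetP => x'; rewrite !inE => /andP[x'X x'x]; rewrite x'X /=.
  by apply: leq_trans sx; apply: adm_homo; rewrite ltnW // idx_ltP.
suff : (#|D| <= rank X x)%N by move: sx; clear; lia.
apply/subset_leq_card/subsetP => x'; rewrite !inE => /andP[x'X x'y].
rewrite x'X /= -idx_ltP // ltnNge; apply/negP => /adm_homo; lia.
Qed.

Lemma place_lt x y : (x < y)%O -> (place s x < place s y)%N.
Proof.
move=> xy.
case: (boolP (x \in X)) => [xX|]; last rewrite (two_chain_notX x) => xY.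
  case: (boolP (y \in X)) => [yX|]; last rewrite (two_chain_notX y) => yY.
    rewrite !placeX //; have := rank_lt xX xy.
    by have := @adm_homo (idx y) (idx x); rewrite idx_leP // ltW // => /(_ isT); lia.
  have := place_XY xX yY; case: (leqP (s (idx x))) => // lt_s _.
  (* Here the ceiling enters: the elements of Y not above x all lie below y, so [s (idx x)] is at
     most the rank of y. *)
  exfalso; move: lt_s; apply/negP; rewrite -leqNgt.
  have [_ /(_ (idx x)) sc _] := adms; apply: leq_trans sc _.
  rewrite ceiling_idx //; apply/subset_leq_card/subsetP => z.
  rewrite !inE => /andP[zY nxz]; rewrite zY /=.
  have := chY zY yY; case: comparableP => // [yz | zy]; last by rewrite zy xy in nxz.
  by rewrite (lt_trans xy yz) in nxz.
case: (boolP (y \in X)) => [yX|]; last rewrite (two_chain_notX y) => yY.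
  by move: xy; rewrite (two_chain_nlt yX xY).
rewrite !placeY //; have r := rank_lt xY xy.
suff : (#|[set w in X | (s (idx w) <= rank Y x)%N]|
  <= #|[set w in X | (s (idx w) <= rank Y y)%N]|)%N by lia.
apply/subset_leq_card/subsetP => w; rewrite !inE => /andP[-> /leq_trans]; apply.
exact: ltnW.
Qed.

Lemma place_inj : injective (place s).
Proof.
move=> x y eqp.
have chain_case (C : {set P}) : is_chain C -> x \in C -> y \in C -> x = y.
  move=> chC xC yC; have := chC _ _ xC yC.
  by case: comparableP => // /place_lt; rewrite eqp ltnn.
case: (boolP (x \in X)) => [xX|]; last rewrite (two_chain_notX x) => xY.
  case: (boolP (y \in X)) => [yX|]; first exact: (chain_case X).
  rewrite (two_chain_notX y) => yY.
  by have := place_XY xX yY; rewrite eqp ltnn if_same.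
case: (boolP (y \in X)) => [yX|]; last rewrite (two_chain_notX y) => yY.
  by have := place_XY yX xY; rewrite eqp ltnn if_same.
exact: (chain_case Y).
Qed.

Lemma place_bound z : (place s z < #|P|)%N.
Proof.
have cardP : #|P| = (#|X| + #|Y|)%N.
  rewrite -cardsT -(cardsID X [set: P]) setTI setTD; congr (_ + _)%N.
  by apply: eq_card => w; rewrite !inE two_chain_notX.
case: (boolP (z \in X)) => [zX|].
  by rewrite placeX // cardP; have := rank_bound zX; have := adm_le_Y (idx z); lia.
rewrite two_chain_notX => zY; rewrite placeY // cardP; have := rank_bound zY.
have : (#|[set x in X | (s (idx x) <= rank Y z)%N]| <= #|X|)%N.
  by apply/subset_leq_card/subsetP => x; rewrite inE => /andP[].
lia.
Qed.

Lemma profile_onto : exists2 f, f \in linext & profile f = s.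
Proof.
pose f : {ffun P -> 'I_#|P|} := [ffun z => Ordinal (place_bound z)].
have fE z : f z = place s z :> nat by rewrite ffunE.
have fL : f \in linext.
  rewrite inE; apply/andP; split.
    by apply/injectiveP => x y /(congr1 val); rewrite /= !fE; apply: place_inj.
  apply/forallP => x; apply/forallP => y; apply/implyP; rewrite !fE le_eqVlt.
  by move=> /predU1P[-> // | /place_lt/ltnW].
exists f => //; apply/funext => k; have [s0 sc _] := adms.
have [-> // | k_gt0] := posnP k.
have [kX | /ceiling_out c0] := leqP k #|X|; last first.
  have [_ /(_ k) + _] := profile_admissible fL; have := sc k.
  by rewrite c0 !leqn0 => /eqP -> /eqP ->.
have [x xX <-] : exists2 x, x \in X & idx x = k by apply: idx_onto; rewrite k_gt0.
rewrite profile_idx // -[RHS](card_inj_ltn (rank_inj chY) (@rank_bound _ _ Y) (adm_le_Y _)).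
apply: eq_card => y; rewrite !inE; case: (boolP (y \in Y)) => //= yY.
rewrite !fE; have := place_XY xX yY; case: (leqP (s (idx x))) => // _ /ltnW.
by rewrite leqNgt => /negbTE.
Qed.

End Place.

(** * Variances of positions and the ceiling of a mu-pair *)

Section Sigma.
Variable R : realType.

Local Notation VarX := (variance (R := R) linext profile).

(** The sequence vanishing after index 0 is admissible; it places all of X before Y. *)
Lemma linext_neq0 : linext != set0.
Proof.
have [|f fL _] := @profile_onto (fun k => if k == 0%N then #|Y| else 0%N).
  by split=> [//|[|k]|k].
by apply/set0Pn; exists f.
Qed.

(** The position of x and [profile f (idx x)] differ by the constant [rank X x + 1]. *)
Lemma sigma_sqr x : x \in X -> sigma R x ^+ 2 = VarX (idx x).
Proof.
move=> xX; rewrite /sigma sqr_sqrtr; last first.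
  by rewrite /linext_mean divr_ge0 // sumr_ge0 // => f _; rewrite sqr_ge0.
pose q := (rank X x).+1%:R : R.
have posE f : f \in linext -> position R x f = q + (profile f (idx x))%:R.
  by move=> fL; rewrite /position linext_place // placeX // -natrD addSn.
have card0 : #|linext|%:R != 0 :> R by rewrite pnatr_eq0 cards_eq0 linext_neq0.
have meanE : linext_mean (position R x) = q + mean (R := R) linext profile (idx x).
  rewrite /linext_mean /mean /Ex (eq_bigr _ posE) big_split sumr_const mulrDl /=.
  by rewrite -[q *+ _]mulr_natr mulfK.
rewrite meanE /linext_mean /variance /Ex; congr (_ / _).
by apply: eq_bigr => f /posE ->; congr (_ ^+ 2); ring.
Qed.

Variables (mu : R) (A B : {set P}).
Hypotheses (muAB : mu_pair mu A B) (AX : A \subset X) (BY : B \subset Y).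

Lemma incomparable_nlt x y : x \in A -> y \in B -> ~~ (x < y)%O.
Proof.
move=> xA yB; have [[_ inc] _] := muAB.
by have := inc x y xA yB; case: comparableP.
Qed.

(** If z in X has index k, then x <= z, so z < y with y in B would give x < y. *)
Lemma ceiling_ge x k : x \in A -> (k <= idx x)%N -> (#|B| <= ceiling k)%N.
Proof.
move=> xA kx; have xX := subsetP AX x xA.
have [-> | k_gt0] := posnP k; first exact: subset_leq_card.
have [z zX iz] : exists2 z, z \in X & idx z = k.
  by apply: idx_onto; rewrite k_gt0 (leq_trans kx) ?idx_le.
rewrite -iz ceiling_idx //; apply/subset_leq_card/subsetP => y yB.
rewrite inE (subsetP BY) //=; apply: contra (incomparable_nlt xA yB).
by apply: le_lt_trans; rewrite -idx_leP // iz.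
Qed.

(* The elements of X with index at most J against the y's not above the
   lowest of them form an incomparable pair. *)
Lemma ceiling_le J : (0 < J)%N ->
  mu * (J%:R * (ceiling J)%:R) <= #|A|%:R * #|B|%:R.
Proof.
move=> J0; have [JX | /ceiling_out ->] := leqP J #|X|; last first.
  by rewrite !mulr0 mulr_ge0.
have [x xX ix] : exists2 x, x \in X & idx x = J by apply: idx_onto; rewrite J0.
rewrite -ix ceiling_idx //; set D := [set y in Y | _].
have -> : idx x = #|[set z in X | (x <= z)%O]|.
  rewrite /idx /rank -(cardsID [set w in X | (w < x)%O] X).
  have -> : X :&: [set w in X | (w < x)%O] = [set w in X | (w < x)%O].
    by apply/setIidPr/subsetP => w; rewrite inE => /andP[].
  rewrite addKn; apply: eq_card => z; rewrite !inE.
  case: (boolP (z \in X)) => //= zX; rewrite andbT.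
  by have := chX xX zX; case: comparableP.
have [_ ] := muAB; apply; split.
  apply/pred0P => z /=; rewrite !inE; apply/negP => /andP[/andP[zX _] /andP[zY _]].
  by move: zY; rewrite -two_chain_notX zX.
move=> z y; rewrite !inE => /andP[zX xz] /andP[yY nxy].
have := two_chain_nlt zX yY; case: comparableP => // [zy | eqzy].
  by rewrite (le_lt_trans xz zy) in nxy.
by move: yY; rewrite -eqzy -two_chain_notX zX.
Qed.

End Sigma.

End TwoChains.

Theorem theorem3p2 (R : realType) (mu L : R) (mu_gt0 : 0 < mu) :
  exists K : R,
    forall (d : Order.disp_t) (P : finPOrderType d) (X Y A B : {set P}),
      two_chain_poset X Y ->
      mu_pair mu A B ->
      A \subset X -> B \subset Y ->
      Num.max (mu * #|A|%:R) K <= #|B|%:R ->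
      L * #|A|%:R <= \sum_(x in A) (sigma R x) ^+ 2.
Proof.
(* The 4 absorbs the factor of [sum_variance_ge]; the 1 ensures Lam >= 1. *)
pose Lam := 4 * `|L| + 1.
have normL : 0 <= `|L| by [].
have Lam1 : 1 <= Lam by rewrite lerDr mulr_ge0.
have [x x0 xE] : exists2 x, 0 < x & 16 * x = (mu ^+ 4 / 80) ^+ 2.
  exists ((mu ^+ 4 / 80) ^+ 2 / 16); last by field.
  by rewrite !(divr_gt0, exprn_gt0).
(* [r], [M0] and [K] are read off the last three numerical hypotheses of [sum_variance_ge]; they
   depend on mu and L alone. *)
pose r := (Num.truncn (256 * Lam / (x * mu))).+1.
pose M0 := (Num.truncn (128 * Lam * (1 + 4 * Lam / x) / x)).+1.
pose K := 5120 * (r * M0.+1)%:R * Lam / mu ^+ 3 + 1.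
have lt_bound y : y < (Num.truncn y).+1%:R :> R.
  by rewrite real_truncnS_gt ?num_real.
exists K => d P X Y A B tc muAB AX BY.
rewrite ge_max => /andP[ab bK].
have [-> | /set0Pn[z zA]] := eqVneq A set0; first by rewrite cards0 mulr0 big_set0.
have A0 : (0 < #|A|)%N by apply/card_gt0P; exists z.
have K0 : 0 < K.
  by rewrite ltr_wpDl // divr_ge0 ?exprn_ge0 ?mulr_ge0 // ltW // (lt_le_trans ltr01).
have b0 : (0 < #|B|)%N by rewrite -(ltr_nat R) (lt_le_trans K0).
(* The lowest element of A has the largest index, which serves as [k0]. *)
have [w wA wmax] := eq_bigmax_cond (idx X) A0.
have ks_le : {in [seq idx X x | x <- enum A], forall k, (0 < k <= idx X w)%N}.
  move=> _ /mapP[v vA ->]; rewrite mem_enum in vA.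
  by rewrite (idx_gt0 (subsetP AX v vA)) -wmax leq_bigmax_cond.
have uks : uniq [seq idx X x | x <- enum A].
  rewrite map_inj_in_uniq ?enum_uniq // => u v; rewrite !mem_enum => uA vA.
  by apply: (idx_inj tc); apply: (subsetP AX).
have size_ks : size [seq idx X x | x <- enum A] = #|A| by rewrite size_map -cardE.
have := @sum_variance_ge R _ linext (profile X Y) (ceiling X Y)
  (profile_admissible tc) (@profile_onto _ _ _ _ tc) (profile_inj tc)
  (linext_neq0 tc) mu x Lam #|B| (idx X w) r M0 _ uks ks_le mu_gt0 b0.
rewrite size_ks big_map big_enum /= => /(_ ab).
have -> : \sum_(v in A) variance linext (profile X Y) (idx X v)
  = \sum_(v in A) sigma R v ^+ 2.
  by apply: eq_bigr => v vA; rewrite (sigma_sqr tc) // (subsetP AX).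
move=> main; suff : Lam * #|A|%:R <= 4 * \sum_(v in A) sigma R v ^+ 2.
  have : L * #|A|%:R <= `|L| * #|A|%:R by rewrite ler_wpM2r // ler_norm.
  by have : 0 <= #|A|%:R :> R by []; rewrite /Lam; lra.
apply: main => //.
- by move=> k; apply: (ceiling_ge tc muAB AX BY wA).
- exact: (ceiling_le tc muAB).
- by rewrite -mulrA -ltr_pdivrMr ?mulr_gt0 //; apply: lt_bound.
- by rewrite -ler_pdivrMr //; apply/ltW/lt_bound.
- rewrite [ltRHS]mulrC -ltr_pdivrMr ?exprn_gt0 //; apply: lt_le_trans bK.
  by rewrite ltrDl.
Qed.
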